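(* Let $\epsilon=\epsilon_R>0$ be a function of $R>0$ with $\epsilon\to0$ as $R\to\infty$. (i) If $\alpha\in\mathbb{R}$ is irrational of finite type $\eta$ and $\epsilon R^{1+1/\eta}\to\infty$ as $R\to\infty$, then $$S_\alpha(\epsilon,R)\sim\mathrm{Area}(\mathrm{Sect}_{\alpha,\epsilon}(R))\quad\text{as }R\to\infty.$$ (ii) In particular, if $\alpha\in\mathbb{R}$ is Diophantine and $\epsilon R^{t}\to\infty$ as $R\to\infty$ for some $t<2$, then $$S_\alpha(\epsilon,R)\sim\mathrm{Area}(\mathrm{Sect}_{\alpha,\epsilon}(R))\quad\text{as }R\to\infty.$$
   Context: An irrational $\alpha\in\mathbb{R}$ is said to be of finite type $\eta$ (a real number) if there exists a constant $c=c(\alpha)>0$ such that $\left|\alpha-\frac pq\right|>\frac{c}{q^{1+\eta}}$ for all pairs $(p,q)\in\mathbb{Z}\times\mathbb{Z}_{>0}$ (necessarily $\eta\ge1$ by Dirichlet's theorem). An irrational $\alpha\in\mathbb{R}$ is called Diophantine if it is of type $\eta=1+\varepsilon$ for every $\varepsilon>0$ (the constant $c$ may depend on $\varepsilon$). For $\alpha\in\mathbb{R}$, $\epsilon>0$, $R>0$ define the sector $$\mathrm{Sect}_{\alpha,\epsilon}(R):=\{(x,y)\in\mathbb{R}_{>0}\times\mathbb{R}:\ x^2+y^2\le R^2,\ \alpha-\epsilon<y/x<\alpha+\epsilon\},$$ whose area is $\mathrm{Area}(\mathrm{Sect}_{\alpha,\epsilon}(R))=\frac{R^2}{2}\left(\tan^{-1}(\alpha+\epsilon)-\tan^{-1}(\alpha-\epsilon)\right)$,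 and let $$S_\alpha(\epsilon,R):=\#\left(\mathbb{Z}^2\cap \mathrm{Sect}_{\alpha,\epsilon}(R)\right)=\#\{(m,n)\in\mathbb{Z}_{>0}\times\mathbb{Z}: m^2+n^2\le R^2,\ |n-\alpha m|<m\epsilon\}.$$ The notation $f\sim g$ as $R\to\infty$ means $f/g\to1$. *)

(* Defs.v *)
From HB Require Import structures.
From mathcomp Require Import all_boot all_order all_algebra.
From mathcomp Require Import finmap.
From mathcomp Require Import all_classical all_reals all_analysis.
Set Implicit Arguments.
Unset Strict Implicit.
Unset Printing Implicit Defensive.
Import Order.TTheory GRing.Theory Num.Theory.
Import numFieldNormedType.Exports.
Local Open Scope classical_set_scope.
Local Open Scope ring_scope.

Definition of_type (R : realType) (alpha eta : R) : Prop :=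
  exists2 c : R, 0 < c &
    forall (p : int) (q : nat), (0 < q)%N ->
      c / (q%:R `^ (1 + eta)) < `|alpha - p%:~R / q%:R|.

Definition diophantine (R : realType) (alpha : R) : Prop :=
  irrational alpha /\ forall e : R, 0 < e -> of_type alpha (1 + e).

Definition sect (R : realType) (alpha e r : R) : set (R * R) :=
  [set v | [/\ 0 < v.1, v.1 ^+ 2 + v.2 ^+ 2 <= r ^+ 2
             & alpha - e < v.2 / v.1 < alpha + e]].

(* Planar Lebesgue measure; [fine] is harmless because sectors are bounded. *)
Definition area (R : realType) (A : set (R * R)) : R :=
  fine ((@lebesgue_measure R \x @lebesgue_measure R)%E A).

Definition lattice_pts (R : realType) (A : set (R * R)) : set (int * int) :=
  [set p | A (p.1%:~R, p.2%:~R)].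

(* [fset_set] sends infinite sets to the empty one, so the cardinality below is
   the intended one only thanks to finiteness. *)
Lemma finite_lattice_pts_sect (R : realType) (alpha e r : R) :
  finite_set (lattice_pts (sect alpha e r)).
Proof.
have [N rN] : exists N : nat, `|r| <= N%:R.
  by exists (Num.truncn `|r|).+1; rewrite ltW// truncnS_gt.
have bound (m : int) (x : R) : m%:~R ^+ 2 + x ^+ 2 <= r ^+ 2 -> (`|m| <= N)%N.
  move=> h.
  have h2 : (m%:~R : R) ^+ 2 <= r ^+ 2 by apply: le_trans h; rewrite lerDl sqr_ge0.
  have : `|m%:~R : R| <= `|r| by rewrite -ler_sqr ?nnegrE// !real_normK ?num_real.
  move=> /le_trans /(_ rN).
  by rewrite -intr_norm -[N%:R]/(N%:Z%:~R) ler_int -abszE.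
pose B := [set m : int | (`|m| <= N)%N].
have finB : finite_set B.
  apply: (@sub_finite_set _ _
    ((fun k : nat => k%:Z) @` `I_N.+1 `|` (fun k : nat => - k%:Z) @` `I_N.+1)).
    move=> m /= mN; case: (leP 0 m) => m0.
      by left; exists `|m|%N => //=; rewrite gez0_abs.
    by right; exists `|m|%N => //=; rewrite ltz0_abs// opprK.
  by rewrite finite_setU; split; apply: finite_image; exact: finite_II.
apply: (@sub_finite_set _ _ (B `*` B)); last exact: finite_setX.
move=> [m n] /= [_ /= h _]; split=> /=; first exact: bound h.
by apply: (bound _ m%:~R); rewrite addrC.
Qed.

Definition sect_count (R : realType) (alpha e r : R) : nat :=
  #|` fset_set (lattice_pts (sect alpha e r))|.

Definition asymp_pinfty (R : realType) (f g : R -> R) : Prop :=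
  (f r / g r) @[r --> +oo] --> (1 : R).

(* Main.v *)
Require Import Defs.
From HB Require Import structures.
From mathcomp Require Import all_boot all_order all_algebra finmap.
From mathcomp Require Import all_classical all_reals all_analysis.
From mathcomp Require Import measurable_realfun.
From mathcomp Require Import ring lra zify.
Import Order.TTheory GRing.Theory Num.Theory.
Import numFieldNormedType.Exports.
Local Open Scope classical_set_scope.
Local Open Scope ring_scope.

(** Set T(x) = {(u, v) : 0 < u <= x, |v - alpha u| < e u}, a triangle of area
e x^2. With k = sqrt (1 + alpha^2), the sector of radius r lies between the
triangles T((1 - t) r / k) and T((1 + t) r / k) as soon as e is small compared
to t ([tri_sub_sect], [sect_sub_tri]). Hence any monotone quantity that is
asymptotic to e x^2 on triangles is asymptotic to e r^2 / (1 + alpha^2) on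
sectors ([sandwich]). This is applied twice, to the area and to the number of
lattice points, and the two asymptotics are divided by each other
([sect_count_asymp]).

For the area the value e x^2 is exact ([lebesgue_tri]). For lattice points, let
p / q be a reduced fraction with |alpha - p / q| <= 1 / q^2. On q consecutive
columns m, the map (m, n) |-> n q - p m is a bijection onto the integers, and
n - alpha m differs from (n q - p m) / q by a constant up to an error at most
1 / q. So the number of points with |n - alpha m| < d on these columns is
2 d q + O(1), with no loss from the distribution of the fractional parts
([card_block]). Cutting the triangle into x / q such blocks gives e x^2 with an
error of order e x q + x / q ([card_stack], [card_tri]). This is small relative
to e x^2 when q is a small multiple of x at most, while e x q is large.

Such a q comes from approximating alpha with denominators up to a small multiple
N of x. By Dirichlet some q <= N has |q alpha - p| < 1 / N, and finite type
forces q^eta > c N, that is q > (c N)^(1 / eta) ([of_type_approx]). Then e x q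
is at least a constant times e x^(1 + 1 / eta), which tends to infinity by
hypothesis. A Diophantine number has type 1 + delta for all delta > 0, and
1 + 1 / (1 + delta) exceeds any given t < 2 for delta small. *)

Set Implicit Arguments.
Unset Strict Implicit.

(** * Cardinality of finite sets and integers in an interval *)

Lemma leq_card_fset_set_sub (T : choiceType) (A B : set T) :
  finite_set B -> A `<=` B -> (#|` fset_set A| <= #|` fset_set B|)%N.
Proof.
move=> finB AB; apply: fsubset_leq_card.
by rewrite -fset_set_sub //; exact: sub_finite_set finB.
Qed.

Lemma card_fset_set_inj (T U : choiceType) (f : T -> U) (A : set T) :
  finite_set A -> {in A &, injective f} ->
  #|` fset_set (f @` A)| = #|` fset_set A|.
Proof.
move=> finA fI; rewrite fset_set_image // card_in_imfset //= => x y xA yA.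
by apply: fI; rewrite -in_fset_set.
Qed.

Lemma card_fset_setU (T : choiceType) (A B : set T) :
  finite_set A -> finite_set B -> A `&` B = set0 ->
  #|` fset_set (A `|` B)| = (#|` fset_set A| + #|` fset_set B|)%N.
Proof.
move=> finA finB AB; rewrite fset_setU // cardfsU -fset_setI // AB.
by rewrite fset_set0 cardfs0 subn0.
Qed.

Lemma int_itvE (R : realType) (a b : R) :
  Num.floor a < Num.ceil b ->
  [set k : int | a < k%:~R < b] =
  (fun i : nat => Num.floor a + 1 + i%:Z) @` `I_(`|(Num.ceil b - Num.floor a - 1)%R|%N).
Proof.
move=> ab; apply/seteqP; split=> [k /= /andP[ak kb]|_ /= [i iN <-]].
  have h1 : Num.floor a < k by rewrite floor_lt_int.
  have h2 : k < Num.ceil b by rewrite ltNge ceil_le_int -ltNge.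
  by exists `|(k - Num.floor a - 1)%R|%N; rewrite /=; lia.
have h1 : Num.floor a < Num.floor a + 1 + i%:Z by lia.
have h2 : Num.floor a + 1 + i%:Z < Num.ceil b by lia.
by rewrite -floor_lt_int h1 ltNge -ceil_le_int -ltNge.
Qed.

Lemma finite_int_itv (R : realType) (a b : R) :
  finite_set [set k : int | a < k%:~R < b].
Proof.
have [ab|ba] := ltP (Num.floor a) (Num.ceil b).
  by rewrite int_itvE //; apply: finite_image; exact: finite_II.
apply: (@sub_finite_set _ _ set0) => // k /= /andP[ak kb].
have h1 : Num.floor a < k by rewrite floor_lt_int.
have h2 : k < Num.ceil b by rewrite ltNge ceil_le_int -ltNge.
lia.
Qed.

Lemma card_int_itv_ge (R : realType) (a b : R) :
  b - a - 1 <= #|` fset_set [set k : int | a < k%:~R < b]|%:R.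
Proof.
have fa := floor_le a.
have cb := ceil_ge b.
have [ab|ba] := ltP (Num.floor a) (Num.ceil b).
  rewrite int_itvE // card_fset_set_inj; [|exact: finite_II|by move=> i j _ _; lia].
  rewrite (card_fset_set (card_eqxx _)).
  rewrite natr_absz ger0_norm; last lia.
  rewrite !intrD !intrN; lra.
apply: (@le_trans _ _ 0); last by [].
have : (Num.ceil b)%:~R <= (Num.floor a)%:~R :> R by rewrite ler_int.
lra.
Qed.

Lemma card_int_itv_le (R : realType) (a b : R) : a <= b ->
  #|` fset_set [set k : int | a < k%:~R < b]|%:R <= b - a + 1.
Proof.
move=> leab.
have fa := floorD1_gt a.
have cb := ceilB1_lt b.
rewrite ?intrD ?intrB in fa cb.
have [ab|ba] := ltP (Num.floor a) (Num.ceil b).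
  rewrite int_itvE // card_fset_set_inj; [|exact: finite_II|by move=> i j _ _; lia].
  rewrite (card_fset_set (card_eqxx _)).
  rewrite natr_absz ger0_norm; last lia.
  rewrite !intrD !intrN; lra.
suff -> : [set k : int | a < k%:~R < b] = set0 by rewrite fset_set0 cardfs0; lra.
apply/seteqP; split=> // k /= /andP[ak kb].
have h1 : Num.floor a < k by rewrite floor_lt_int.
have h2 : k < Num.ceil b by rewrite ltNge ceil_le_int -ltNge.
lia.
Qed.

(** * Lattice points above q consecutive columns *)

Section blocks.
Context {R : realType}.
Implicit Types (alpha d e : R) (a p : int) (q : nat).

Definition strip a q : set (int * int) := [set v | a < v.1 <= a + q].

Definition form p q (v : int * int) : int := v.2 * q%:Z - p * v.1.

Definition block alpha d a q : set (int * int) :=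
  [set v | strip a q v /\ `|v.2%:~R - alpha * v.1%:~R| < d].

(** If n q - p m takes the same value twice, then q divides p (m - m'), hence
m - m', whose absolute value is less than q. *)
Lemma form_inj p q a : (0 < q)%N -> coprimez p q ->
  {in strip a q &, injective (form p q)}.
Proof.
move=> q0 pq [m n] [m' n']; rewrite !inE /strip /form /= => hm hm' h.
have hd : n * q%:Z - n' * q%:Z = p * (m - m') by lia.
have : (q %| p * (m - m'))%Z by rewrite -hd -mulrBl dvdz_mull.
rewrite Gauss_dvdzr; last by rewrite coprimez_sym.
move=> /dvdzP[t ht].
have t0 : t = 0 by nia.
have mm : m = m' by nia.
by congr pair => //; subst m'; nia.
Qed.

(** Bezout solves n q - p m = k, and shifting (m, n) by multiples of (q, p)
brings m into the window. *)
Lemma form_surj p q a : (0 < q)%N -> coprimez p q ->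
  form p q @` strip a q = setT.
Proof.
move=> q0 /coprimezP[[u v] /= uv]; rewrite -subTset => k _.
pose t := ((- k * u - a - 1) %/ q)%Z.
have hq : (q : int) != 0 by lia.
have := divz_eq (- k * u - a - 1) q; rewrite -/t.
have := modz_ge0 (- k * u - a - 1) hq.
have := ltz_pmod (- k * u - a - 1) (_ : 0 < q%:Z); rewrite -[0 < q%:Z]/(0 < q)%N.
set r := (_ %% _)%Z => /(_ q0) rq r0 e.
exists (- k * u - q%:Z * t, k * v - p * t) => /=.
  by rewrite /strip /=; lia.
by rewrite /form /= -[RHS]mulr1 -uv; ring.
Qed.

(** Writing m = a + i with 0 < i <= q, the error is (alpha - p / q) i, and
|alpha - p / q| i <= q / q^2. *)
Lemma dist_form alpha p q a v (k := (form p q v)%:~R) : (0 < q)%N ->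
  `|alpha - p%:~R / q%:R| <= (q%:R ^+ 2)^-1 -> strip a q v ->
  `|(v.2%:~R - alpha * v.1%:~R)
    - (k / q%:R - (alpha - p%:~R / q%:R) * a%:~R)| <= q%:R^-1.
Proof.
move=> q0 hq; case: v @k => m n k; rewrite /strip /= => /andP[am ma].
have q0' : 0 < q%:R :> R by rewrite ltr0n.
have -> : n%:~R - alpha * m%:~R - (k / q%:R - (alpha - p%:~R / q%:R) * a%:~R)
   = - (alpha - p%:~R / q%:R) * (m - a)%:~R.
  rewrite /k /form /= !(intrB, intrM) -pmulrn; field.
  by rewrite gt_eqF.
rewrite normrM normrN (@ger0_norm _ _%:~R) ?ler0z; last lia.
have h : (m - a)%:~R <= q%:R :> R.
  by rewrite -[q%:R]/(q%:Z%:~R) ler_int; lia.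
apply: le_trans (ler_pM _ _ hq h) _ => //; first by rewrite ler0z; lia.
by rewrite expr2 invfM -mulrA mulVf ?mulr1 // gt_eqF.
Qed.

(** Through the bijection [form] the block becomes, up to an error 1 on each
side, the set of integers in an interval of length 2 d q. *)
Lemma card_block alpha d p q a : (0 < q)%N -> coprimez p q ->
  `|alpha - p%:~R / q%:R| <= (q%:R ^+ 2)^-1 ->
  [/\ finite_set (block alpha d a q),
      2 * d * q%:R - 3 <= #|` fset_set (block alpha d a q)|%:R &
      0 <= d -> #|` fset_set (block alpha d a q)|%:R <= 2 * d * q%:R + 3].
Proof.
move=> q0 pq hq.
have q0' : 0 < q%:R :> R by rewrite ltr0n.
(* Centre of the interval in which n q - p m varies. *)
pose c : R := q%:R * ((alpha - p%:~R / q%:R) * a%:~R).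
have fI : {in block alpha d a q &, injective (form p q)}.
  move=> v w; rewrite !inE => -[hv _] [hw _].
  by apply: (form_inj q0 pq (a := a)); rewrite inE.
have key v : strip a q v ->
    `|q%:R * (v.2%:~R - alpha * v.1%:~R) - ((form p q v)%:~R - c)| <= 1.
  move=> hv; have := dist_form q0 hq hv.
  rewrite -(ler_pM2l q0') divff ?gt_eqF // => h.
  rewrite (_ : q%:R * _ - _ = q%:R * (v.2%:~R - alpha * v.1%:~R
      - ((form p q v)%:~R / q%:R - (alpha - p%:~R / q%:R) * a%:~R))).
    by rewrite normrM gtr0_norm.
  by rewrite /c; field; rewrite gt_eqF.
have sub1 : form p q @` block alpha d a q `<=`
    [set k | c - d * q%:R - 1 < k%:~R < c + d * q%:R + 1].
  move=> _ /= [v [hv hd] <-]; have := key _ hv.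
  have : `|q%:R * (v.2%:~R - alpha * v.1%:~R)| < d * q%:R.
    by rewrite normrM gtr0_norm // mulrC ltr_pM2r.
  rewrite ltr_norml ler_norml; lra.
have sub2 : [set k | c - d * q%:R + 1 < k%:~R < c + d * q%:R - 1] `<=`
    form p q @` block alpha d a q.
  move=> k /= hk; have [v hv vk] : (form p q @` strip a q) k by rewrite form_surj.
  exists v => //; split => //; have := key _ hv.
  rewrite -(ltr_pM2l q0') -[X in X * `|_|](gtr0_norm q0') -normrM vk.
  rewrite ltr_norml ler_norml (mulrC _ d); lra.
have finI : finite_set (form p q @` block alpha d a q).
  by apply: sub_finite_set sub1 _; exact: finite_int_itv.
have finB : finite_set (block alpha d a q).
  by rewrite -(eq_finite_set (inj_card_eq fI)).
split => // [|d0]; rewrite -(card_fset_set_inj finB fI).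
- have := card_int_itv_ge (c - d * q%:R + 1) (c + d * q%:R - 1).
  have := leq_card_fset_set_sub finI sub2.
  rewrite -(ler_nat R); lra.
- have := leq_card_fset_set_sub (finite_int_itv _ _) sub1.
  have /card_int_itv_le : c - d * q%:R - 1 <= c + d * q%:R + 1.
    have : 0 <= d * q%:R by rewrite mulr_ge0.
    lra.
  rewrite -(ler_nat R); lra.
Qed.

End blocks.

(** * Lattice points of a triangle *)

Section triangle_count.
Context {R : realType}.
Implicit Types (alpha e x t : R) (p : int) (q K : nat).

Definition tri alpha e x : set (R * R) :=
  [set v | 0 < v.1 <= x /\ `|v.2 - alpha * v.1| < e * v.1].

(** The lattice points of a triangle made of exactly K blocks of q columns. *)
Definition stack alpha e q K : set (int * int) :=
  lattice_pts (tri alpha e (K * q)%:R).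

(** On the block of columns K q < m <= (K + 1) q the half-width e m lies between
e K q and e (K + 1) q, and [card_block] applies to both constant widths; the
two bounds are the sums over the blocks. *)
Lemma card_stack alpha e p q K : 0 <= e -> (0 < q)%N -> coprimez p q ->
  `|alpha - p%:~R / q%:R| <= (q%:R ^+ 2)^-1 ->
  [/\ finite_set (stack alpha e q K),
      e * q%:R ^+ 2 * (K%:R * (K%:R - 1)) - 3 * K%:R
        <= #|` fset_set (stack alpha e q K)|%:R &
      #|` fset_set (stack alpha e q K)|%:R
        <= e * q%:R ^+ 2 * (K%:R * (K%:R + 1)) + 3 * K%:R].
Proof.
move=> e0 q0 pq hq.
have natz (n : nat) : n%:R = (n%:Z)%:~R :> R by [].
elim: K => [|K [finS loS upS]].
  have -> : stack alpha e q 0 = set0.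
    by apply/seteqP; split=> // -[m n] [/= /andP[m0 /(lt_le_trans m0)]]; rewrite mul0n ltxx.
  by rewrite fset_set0 cardfs0; split=> //; lra.
pose B := stack alpha e q K.+1 `&` strip (K * q)%:Z q.
have SE : stack alpha e q K.+1 = stack alpha e q K `|` B.
  apply/seteqP; split=> [[m n] h|[m n] [|[]//]].
    move: (h) => -[/= /andP[m0 mK] hm].
    rewrite natz ler_int in mK.
    have [mKq|mKq] := leP m (K * q)%:Z.
      by left; split => //=; rewrite m0 natz ler_int.
    by right; split => //; rewrite /strip /= mKq /=; lia.
  move=> [/= /andP[m0 mK] hm]; split => //=; rewrite m0 /=.
  by apply: (le_trans mK); rewrite ler_nat leq_mul2r leqnSn orbT.
have SB0 : stack alpha e q K `&` B = set0.
  apply/seteqP; split=> // -[m n] [[/= /andP[_ h] _]] [_].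
  by rewrite /strip /=; rewrite natz ler_int in h; lia.
pose blk k := block alpha (e * (k * q)%:R) (K * q)%:Z q.
have BU : B `<=` blk K.+1.
  move=> [m n] [[/= /andP[m0 mK] hm] sm]; split=> //=.
  by apply: (lt_le_trans hm); rewrite ler_wpM2l.
have BL : blk K `<=` B.
  move=> [m n] [sm /= hm]; split=> //; move: (sm) => /andP[/= Km mK]; split=> /=.
    by rewrite ltr0z natz ler_int; lia.
  by apply: (lt_le_trans hm); rewrite ler_wpM2l // natz ler_int ltW.
have [finU _ cU] := card_block (e * (K.+1 * q)%:R) (K * q)%:Z q0 pq hq.
have [finL cL _] := card_block (e * (K * q)%:R) (K * q)%:Z q0 pq hq.
have finB : finite_set B by exact: sub_finite_set finU.
rewrite SE finite_setU card_fset_setU //; split=> //.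
  have := leq_card_fset_set_sub finB BL; rewrite -(ler_nat R) => hB.
  rewrite natrD; apply: le_trans (lerD loS (le_trans cL hB)).
  by rewrite natrM -natr1 le_eqVlt; apply/orP; left; apply/eqP; ring.
have := leq_card_fset_set_sub finU BU; rewrite -(ler_nat R) => hB.
have {}cU := cU (mulr_ge0 e0 (ler0n _ _)).
rewrite natrD; apply: le_trans (lerD upS (le_trans hB cU)) _.
by rewrite natrM -natr1 le_eqVlt; apply/orP; left; apply/eqP; ring.
Qed.

(** The triangle lies between the stacks of K and K + 1 blocks, where K is the
integer part of x / q. The two hypotheses on q make each error term of
[card_stack] a multiple of t e x^2. *)
Lemma card_tri alpha e x t p q : 0 < e -> 0 < x -> 0 < t <= 1 / 2 ->
  (0 < q)%N -> coprimez p q ->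
  `|alpha - p%:~R / q%:R| <= (q%:R ^+ 2)^-1 ->
  q%:R <= t * x -> 1 <= t * (e * x * q%:R) ->
  `|#|` fset_set (lattice_pts (tri alpha e x))|%:R - e * x ^+ 2|
    <= 11 * t * (e * x ^+ 2).
Proof.
move=> e0 x0 /andP[t0 t1] q0 pq hq qx qe.
have q0' : 0 < q%:R :> R by rewrite ltr0n.
have ex0 : 0 < e * x ^+ 2 by rewrite mulr_gt0 ?exprn_gt0.
pose y := x / q%:R.
have y0 : 0 <= y by rewrite divr_ge0 // ltW.
have xE : x = y * q%:R by rewrite /y mulfVK // gt_eqF.
pose K := Num.truncn y.
have /andP[Ky yK] : K%:R <= y < K.+1%:R by exact: truncn_itv.
have tri_sub k k' : k <= k' ->
    lattice_pts (tri alpha e k) `<=` lattice_pts (tri alpha e k').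
  by move=> kk [m n] [/andP[m0 mk] hm]; split=> //; rewrite m0 /= (le_trans mk).
have [finL cL _] := card_stack K (ltW e0) q0 pq hq.
have [finU _ cU] := card_stack K.+1 (ltW e0) q0 pq hq.
have subU : lattice_pts (tri alpha e x) `<=` stack alpha e q K.+1.
  by apply: tri_sub; rewrite xE natrM ler_wpM2r // ltW.
have subL : stack alpha e q K `<=` lattice_pts (tri alpha e x).
  by apply: tri_sub; rewrite xE natrM ler_wpM2r.
have finT := sub_finite_set subU finU.
have := leq_card_fset_set_sub finT subL; rewrite -(ler_nat R) => /(le_trans cL) {}cL.
have := leq_card_fset_set_sub finU subU; rewrite -(ler_nat R) => /le_trans /(_ cU) {}cU.
rewrite -natr1 in cU yK.
set k : R := K%:R in cL cU Ky yK.
have k0 : 0 <= k by [].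
have ty : 1 <= t * y.
  by rewrite -(ler_pM2r q0') mul1r -mulrA -xE.
have yt : y <= t * (e * x ^+ 2).
  rewrite -[leLHS]mul1r; apply: (le_trans (ler_wpM2r y0 qe)).
  by rewrite xE le_eqVlt; apply/orP; left; apply/eqP; ring.
have eE : e * x ^+ 2 = e * q%:R ^+ 2 * y ^+ 2 by rewrite {1}xE; ring.
have eq0 : 0 < e * q%:R ^+ 2 by rewrite mulr_gt0 ?exprn_gt0.
have hL : y ^+ 2 * (1 - 3 * t) <= k * (k - 1).
  have h1 : (1 - t) * y <= k by lra.
  have h2 : (1 - 2 * t) * y <= k - 1 by lra.
  have h3 : 0 <= (1 - 2 * t) * y by rewrite mulr_ge0 //; lra.
  have h4 : 0 <= (1 - t) * y by rewrite mulr_ge0 //; lra.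
  apply: le_trans (ler_pM h4 h3 h1 h2).
  have : 0 <= 2 * t ^+ 2 * y ^+ 2 by rewrite !mulr_ge0 ?exprn_ge0 // ltW.
  lra.
have hU : (k + 1) * (k + 1 + 1) <= y ^+ 2 * (1 + 4 * t).
  have h1 : k + 1 <= (1 + t) * y by lra.
  have h2 : k + 1 + 1 <= (1 + 2 * t) * y by lra.
  apply: (le_trans (ler_pM _ _ h1 h2)); try lra.
  have : 0 <= t * y ^+ 2 * (1 / 2 - t).
    by rewrite !mulr_ge0 ?exprn_ge0 ?subr_ge0 // ltW.
  lra.
have := ler_wpM2l (ltW eq0) hL; have := ler_wpM2l (ltW eq0) hU.
rewrite !(mulrA _ (y ^+ 2)) -eE => {}hU {}hL.
have ht : 0 <= t * (e * x ^+ 2) by rewrite mulr_ge0 ?ltW.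
have ky : k + 1 <= 2 * y.
  have : 0 <= (1 - t) * y by rewrite mulr_ge0 //; lra.
  lra.
rewrite ler_norml; apply/andP; split; lra.
Qed.

End triangle_count.

(** * Rational approximation of numbers of finite type *)

Section approximation.
Context {R : realType}.
Implicit Types (alpha eta c : R) (p : int) (q N : nat).

(** The N + 1 fractional parts of i alpha, 0 <= i <= N, fall into N boxes of
length 1 / N, so two of them share a box; cancelling the common divisor keeps
the fraction and lowers its denominator. *)
Lemma dirichlet alpha N : (0 < N)%N ->
  exists p q, [/\ (0 < q <= N)%N, coprimez p q &
                  `|alpha - p%:~R / q%:R| < (q%:R * N%:R)^-1].
Proof.
move=> N0.
have N0' : 0 < N%:R :> R by rewrite ltr0n.
pose fr (i : nat) : R := i%:R * alpha - (Num.floor (i%:R * alpha))%:~R.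
have fr01 i : 0 <= fr i < 1.
  by have := floor_itv (i%:R * alpha); rewrite intrD /fr; lra.
have box_lt i : (Num.truncn (N%:R * fr i) < N)%N.
  have /andP[f0 f1] := fr01 i.
  by rewrite truncn_lt_nat ?mulr_ge0 // gtr_pMr.
pose box (i : 'I_N.+1) : 'I_N := Ordinal (box_lt i).
have : ~~ injectiveb box.
  by apply/negP => /injectiveP /leq_card; rewrite !card_ord ltnn.
case/injectivePn => i [j ij /(congr1 val) /= bij].
wlog lij : i j ij bij / (i < j)%N.
  move=> H; have [|ji|/val_inj E] := ltngtP i j; first exact: H.
  - by apply: (H j i) => //; rewrite eq_sym.
  - by rewrite E eqxx in ij.
have close : `|fr j - fr i| < N%:R^-1.
  have /andP[fi0 fi1] := fr01 i; have /andP[fj0 fj1] := fr01 j.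
  rewrite -(ltr_pM2l N0') divff ?gt_eqF //.
  rewrite -[X in X * `|_|](gtr0_norm N0') -normrM mulrBr ltr_norml.
  have := truncn_itv (mulr_ge0 (ltW N0') fi0).
  have := truncn_itv (mulr_ge0 (ltW N0') fj0).
  rewrite bij -natr1; lra.
pose q := (j - i)%N; pose p := Num.floor (j%:R * alpha) - Num.floor (i%:R * alpha).
have q0 : (0 < q)%N by rewrite subn_gt0.
have q0' : 0 < q%:R :> R by rewrite ltr0n.
have qN : (q <= N)%N by rewrite (leq_trans (leq_subr _ _)) // -ltnS.
have apx : `|alpha - p%:~R / q%:R| < (q%:R * N%:R)^-1.
  rewrite -(ltr_pM2l q0') invfM mulrA divff ?gt_eqF // mul1r.
  apply: le_lt_trans close; rewrite -[X in X * `|_|](gtr0_norm q0') -normrM.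
  rewrite mulrBr mulrCA divff ?gt_eqF // mulr1 /p intrB natrB; last exact: ltnW.
  by rewrite /fr le_eqVlt; apply/orP; left; apply/eqP; congr `|_|; ring.
pose d := gcdn `|p|%N q.
have d0 : (0 < d)%N by rewrite gcdn_gt0 q0 orbT.
have d0' : 0 < d%:R :> R by rewrite ltr0n.
have /dvdzP[p' pE] : (d %| p)%Z by rewrite dvdzE dvdn_gcdl.
have /dvdnP[q' qE] : (d %| q)%N by rewrite dvdn_gcdr.
have q'0 : (0 < q')%N by case: (q') qE q0 => // ->.
have q'0' : 0 < q'%:R :> R by rewrite ltr0n.
have q'q : (q' <= q)%N by rewrite qE leq_pmulr.
exists p', q'; split; first by rewrite q'0 (leq_trans q'q).
  have : d = (gcdn `|p'| q' * d)%N.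
    by rewrite muln_gcdl -qE {1}/d pE abszM.
  rewrite -{1}[d]mul1n => /eqP; rewrite eqn_pmul2r // => /eqP h.
  by rewrite coprimezE /coprime /= -h.
have -> : p'%:~R / q'%:R = p%:~R / q%:R :> R.
  by rewrite pE qE intrM natrM -pmulrn; field; rewrite !gt_eqF.
apply: (lt_le_trans apx).
by rewrite lef_pV2 ?posrE ?mulr_gt0 // ler_wpM2r ?ler_nat // ltW.
Qed.

(** A good approximation of a number of finite type has a large denominator:
compare c / q^(1 + eta) < |alpha - p / q| < 1 / (q N). *)
Lemma denominator_powR_gt alpha eta c p q N :
  (forall (p : int) (q : nat), (0 < q)%N ->
     c / (q%:R `^ (1 + eta)) < `|alpha - p%:~R / q%:R|) ->
  (0 < q)%N -> (0 < N)%N -> `|alpha - p%:~R / q%:R| < (q%:R * N%:R)^-1 ->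
  c * N%:R < q%:R `^ eta.
Proof.
move=> ct q0 N0 apx.
have q0' : 0 < q%:R :> R by rewrite ltr0n.
have N0' : 0 < N%:R :> R by rewrite ltr0n.
have := lt_trans (ct p q q0) apx.
rewrite powRD; last by apply/implyP => _; rewrite gt_eqF.
rewrite powRr1; last exact: ltW.
have h0 : 0 < q%:R `^ eta by rewrite powR_gt0.
rewrite ltr_pdivrMr ?mulr_gt0 // invfM [ltRHS](_ : _ = q%:R `^ eta / N%:R).
  by rewrite ltr_pdivlMr.
by field; rewrite !gt_eqF.
Qed.

(** For eta <= 0 the denominator q >= 1 would satisfy q^eta <= 1, against
q^eta > c N for N > 1 / c. *)
Lemma of_type_gt0 alpha eta : of_type alpha eta -> 0 < eta.
Proof.
case=> c c0 ct; rewrite ltNge; apply/negP => eta0.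
pose N := (Num.truncn c^-1).+1.
have [p [q [/andP[q0 _] _ apx]]] := dirichlet alpha (ltn0Sn _ : (0 < N)%N).
have := denominator_powR_gt ct q0 (ltn0Sn _) apx.
have : c * N%:R > 1.
  by rewrite -ltr_pdivrMl // mulr1 /N truncnS_gt.
have : q%:R `^ eta <= q%:R `^ 0 :> R by rewrite ler_powR // ler1n.
by rewrite powRr0 => h1 h2 /(lt_trans h2) /lt_le_trans /(_ h1); rewrite ltxx.
Qed.

(** What finite type is used for: approximation by denominators that are at
most N, yet at least of order N^(1 / eta). *)
Lemma of_type_approx alpha eta : of_type alpha eta ->
  exists2 c : R, 0 < c &
    forall N, (0 < N)%N -> exists p q, [/\ (0 < q <= N)%N, coprimez p q,
      `|alpha - p%:~R / q%:R| <= (q%:R ^+ 2)^-1 &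
      c * N%:R `^ (1 / eta) <= q%:R].
Proof.
move=> ta; have eta0 := of_type_gt0 ta; case: ta => c c0 ct.
exists (c `^ (1 / eta)); first exact: powR_gt0.
move=> N N0; have [p [q [/andP[q0 qN] pq apx]]] := dirichlet alpha N0.
have q0' : 0 < q%:R :> R by rewrite ltr0n.
have N0' : 0 < N%:R :> R by rewrite ltr0n.
exists p, q; split=> //; first by rewrite q0.
  apply: (le_trans (ltW apx)); rewrite expr2.
  by rewrite lef_pV2 ?posrE ?mulr_gt0 // ler_wpM2l ?ler_nat // ltW.
have /ltW h := denominator_powR_gt ct q0 N0 apx.
rewrite -powRM ?(ltW c0) //.
have -> : q%:R = (q%:R `^ eta) `^ (1 / eta) :> R.
  by rewrite -powRrM mul1r divff ?gt_eqF // powRr1 // ltW.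
by rewrite ge0_ler_powR ?nnegrE ?powR_ge0 ?mulr_ge0 // ?invr_ge0 ltW.
Qed.

End approximation.

(** * Areas of triangles and sectors *)

Section sector_area.
Context {R : realType}.
Implicit Types (alpha e x r : R).
Local Notation mu := (@lebesgue_measure R).

Lemma measurable_lt d (T : measurableType d) (f g : T -> R) :
  measurable_fun setT f -> measurable_fun setT g ->
  measurable [set v | f v < g v].
Proof.
move=> mf mg; rewrite -[[set v | _]]setTI -[[set v | _]]preimage_true.
by apply: measurable_fun_ltr.
Qed.

Lemma measurable_le d (T : measurableType d) (f g : T -> R) :
  measurable_fun setT f -> measurable_fun setT g ->
  measurable [set v | f v <= g v].
Proof.
move=> mf mg; rewrite -[[set v | _]]setTI -[[set v | _]]preimage_true.
by apply: measurable_fun_ler.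
Qed.

Lemma sect_cone alpha e (v : R * R) : 0 < v.1 ->
  (alpha - e < v.2 / v.1 < alpha + e) = (`|v.2 - alpha * v.1| < e * v.1).
Proof.
move=> v0; rewrite ltr_pdivlMr // ltr_pdivrMr // ltr_norml; congr (_ && _).
  by apply/idP/idP; lra.
by apply/idP/idP; lra.
Qed.

Lemma measurable_cone alpha e :
  measurable [set v : R * R | `|v.2 - alpha * v.1| < e * v.1].
Proof.
apply: measurable_lt.
  apply: measurableT_comp => //; apply: measurable_funB => //.
  exact: measurable_funM.
exact: measurable_funM.
Qed.

Lemma measurable_tri alpha e x : measurable (tri alpha e x).
Proof.
rewrite (_ : tri _ _ _ = [set v | 0 < v.1] `&` [set v | v.1 <= x] `&`
    [set v | `|v.2 - alpha * v.1| < e * v.1]).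
  apply: measurableI; [apply: measurableI|exact: measurable_cone].
    exact: measurable_lt.
  exact: measurable_le.
by apply/seteqP; split=> v /=; [case=> /andP[] | case=> -[v0 vx] hv; split=> //; apply/andP].
Qed.

Lemma measurable_sect alpha e r : measurable (sect alpha e r).
Proof.
rewrite (_ : sect _ _ _ = [set v | 0 < v.1] `&` [set v | v.1 ^+ 2 + v.2 ^+ 2 <= r ^+ 2] `&`
    [set v | `|v.2 - alpha * v.1| < e * v.1]).
  apply: measurableI; [apply: measurableI|exact: measurable_cone].
    exact: measurable_lt.
  apply: measurable_le => //.
  by apply: measurable_funD; apply: measurable_funX.
apply/seteqP; split=> v /=.
  by case=> v0 vr; rewrite sect_cone.
by case=> -[v0 vr]; rewrite -sect_cone.
Qed.

(** By definition of the product measure this is the integral over 0 < y <= x of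
the length 2 e y of the vertical section. *)
Lemma lebesgue_tri alpha e x : 0 < e -> 0 < x ->
  (mu \x mu)%E (tri alpha e x) = (e * x ^+ 2)%:E.
Proof.
move=> e0 x0; rewrite /product_measure1.
under eq_integral => y _.
  have -> : (mu \o xsection (tri alpha e x)) y
      = ((fun y => (2 * e * y)%:E) \_ `]0, x]) y.
    rewrite /= /patch; case: ifPn; rewrite ?notin_setE ?inE /= ?in_itv /= => hy.
      have -> : xsection (tri alpha e x) y
          = `](alpha * y - e * y), (alpha * y + e * y)[%classic.
        apply/seteqP; split=> z; rewrite /xsection /= in_itv /=.
          by move=> /set_mem[_ /=]; rewrite ltr_norml; lra.
        by move=> hz; apply/mem_set; split=> //=; rewrite ltr_norml; lra.
      have /andP[y0 _] := hy.
      rewrite lebesgue_measure_itv /= lte_fin ifT.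
        by rewrite -EFinB; congr EFin; ring.
      by have := mulr_gt0 e0 y0; lra.
    rewrite (_ : xsection _ _ = set0) ?measure0 //.
    by apply/seteqP; split=> z //; rewrite /xsection /= => /set_mem[/= /hy].
  over.
rewrite -integral_mkcond integral_itv_obnd_cbnd; last first.
  by apply/measurable_EFinP; apply: measurable_funM.
rewrite (@continuous_FTC2 _ _ (fun y => e * y ^+ 2)) //.
- by rewrite expr0n mulr0 sube0.
- apply: continuous_subspaceT => y.
  by apply: cvgM; [exact: cvg_cst|exact: cvg_id].
- have dF (y : R) : derivable (fun y : R => e * y ^+ 2) y 1 by [].
  have cF (y : R) : {for y, continuous (fun y : R => e * y ^+ 2)}.
    by apply/differentiable_continuous/derivable1_diffP.
  split.
  + by move=> y _.
  + by apply: cvg_at_right_filter; exact: cF.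
  + by apply: cvg_at_left_filter; exact: cF.
- move=> y _; rewrite derive1E deriveM //= derive_cst scaler0 addr0.
  by rewrite exp_derive /= expr1 !scaler1 /GRing.scale /=; ring.
Qed.

Lemma area_tri alpha e x : 0 < e -> 0 < x -> area (tri alpha e x) = e * x ^+ 2.
Proof. by move=> e0 x0; rewrite /area lebesgue_tri. Qed.

Lemma area_le (A B : set (R * R)) : measurable A -> measurable B ->
  A `<=` B -> ((mu \x mu)%E B < +oo)%E -> area A <= area B.
Proof.
move=> mA mB AB Boo.
have AB' : ((mu \x mu)%E A <= (mu \x mu)%E B)%E by rewrite le_measure // inE.
rewrite /area fine_le // ge0_fin_numE //.
exact: le_lt_trans AB' Boo.
Qed.

End sector_area.

(** * Comparison of sectors with triangles *)

Section sandwich.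
Context {R : realType}.
Implicit Types (alpha e x r t : R).

(** In a thin cone v.2^2 is close to alpha^2 v.1^2: their difference is
(v.2 - alpha v.1) (v.2 + alpha v.1), at most e (2 |alpha| + e) v.1^2. *)
Lemma sect_norm alpha e t (v : R * R) : t <= 1 / 2 -> 0 < e ->
  e * (2 * `|alpha| + 1) <= t -> 0 < v.1 ->
  `|v.2 - alpha * v.1| < e * v.1 ->
  `|v.1 ^+ 2 + v.2 ^+ 2 - (1 + alpha ^+ 2) * v.1 ^+ 2|
    <= t * ((1 + alpha ^+ 2) * v.1 ^+ 2).
Proof.
case: v => x y /= t1 e0 et x0 hv.
have a0 : 0 <= `|alpha| by [].
have e1 : e <= 1 by have := mulr_ge0 (ltW e0) a0; lra.
have -> : x ^+ 2 + y ^+ 2 - (1 + alpha ^+ 2) * x ^+ 2 = (y - alpha * x) * (y + alpha * x).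
  by ring.
have hy : `|y + alpha * x| <= (2 * `|alpha| + 1) * x.
  have -> : y + alpha * x = (y - alpha * x) + 2 * (alpha * x) by ring.
  apply: (le_trans (ler_normD _ _)).
  rewrite !normrM (gtr0_norm x0) (ger0_norm (ler0n R 2)).
  have : e * x <= x by rewrite ger_pMl.
  lra.
rewrite normrM; apply: (le_trans (ler_pM _ _ (ltW hv) hy)) => //.
have -> : e * x * ((2 * `|alpha| + 1) * x) = e * (2 * `|alpha| + 1) * x ^+ 2 by ring.
have t0 : 0 <= t by have := mulr_ge0 (ltW e0) a0; lra.
apply: (le_trans (ler_wpM2r (sqr_ge0 x) et)); rewrite ler_wpM2l //.
by rewrite ler_peMl ?sqr_ge0 // lerDl sqr_ge0.
Qed.

(** By [sect_norm] the squared norm is at most (1 + t) (1 + alpha^2) v.1^2, and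
(1 + t) (1 - t)^2 <= 1. *)
Lemma tri_sub_sect alpha e t r : t <= 1 / 2 -> 0 < e ->
  e * (2 * `|alpha| + 1) <= t -> 0 < r ->
  tri alpha e ((1 - t) / Num.sqrt (1 + alpha ^+ 2) * r) `<=` sect alpha e r.
Proof.
move=> t1 e0 et r0 v [/andP[v0 vx] hv].
have t0 : 0 <= t by apply: le_trans et; rewrite mulr_ge0 ?(ltW e0) // addr_ge0 // mulr_ge0.
have k0 : 0 < 1 + alpha ^+ 2 by rewrite ltr_pwDl ?sqr_ge0.
have := sect_norm t1 e0 et v0 hv.
set k := 1 + alpha ^+ 2 in k0 vx *; have sk0 : 0 < Num.sqrt k by rewrite sqrtr_gt0.
have sk : Num.sqrt k ^+ 2 = k by rewrite sqr_sqrtr // ltW.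
have h : k * v.1 ^+ 2 <= (1 - t) ^+ 2 * r ^+ 2.
  rewrite mulrAC ler_pdivlMr // in vx.
  have p1 : 0 <= v.1 * Num.sqrt k by rewrite mulr_ge0 ?ltW.
  by rewrite -sk mulrC -!exprMn ler_sqr ?nnegrE // (le_trans p1).
rewrite ler_norml => /andP[_ hn].
split=> //; last by rewrite sect_cone.
have h2 : v.1 ^+ 2 + v.2 ^+ 2 <= (1 + t) * (k * v.1 ^+ 2) by lra.
apply: (le_trans h2); have t1' : 0 <= 1 + t by lra.
apply: (le_trans (ler_wpM2l t1' h)); rewrite mulrA ger_pMl ?exprn_gt0 //.
have : 0 <= t * (1 + t * (1 - t)) by rewrite mulr_ge0 // addr_ge0 // mulr_ge0 //; lra.
lra.
Qed.

(** By [sect_norm] the squared norm is at least (1 - t) (1 + alpha^2) v.1^2, and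
1 <= (1 - t) (1 + t)^2 when t <= 1 / 2. *)
Lemma sect_sub_tri alpha e t r : t <= 1 / 2 -> 0 < e ->
  e * (2 * `|alpha| + 1) <= t -> 0 < r ->
  sect alpha e r `<=` tri alpha e ((1 + t) / Num.sqrt (1 + alpha ^+ 2) * r).
Proof.
move=> t1 e0 et r0 v [v0 vr]; rewrite sect_cone // => hv; split=> //; rewrite v0 /=.
have t0 : 0 <= t by apply: le_trans et; rewrite mulr_ge0 ?(ltW e0) // addr_ge0 // mulr_ge0.
have k0 : 0 < 1 + alpha ^+ 2 by rewrite ltr_pwDl ?sqr_ge0.
have := sect_norm t1 e0 et v0 hv.
set k := 1 + alpha ^+ 2 in k0 *; have sk0 : 0 < Num.sqrt k by rewrite sqrtr_gt0.
have sk : Num.sqrt k ^+ 2 = k by rewrite sqr_sqrtr // ltW.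
rewrite ler_norml => /andP[hn _].
have p1 : 0 <= v.1 * Num.sqrt k by rewrite mulr_ge0 ?ltW.
have p2 : 0 <= (1 + t) * r by rewrite mulr_ge0 ?(ltW r0) //; lra.
rewrite mulrAC ler_pdivlMr // -ler_sqr ?nnegrE //.
rewrite !exprMn sk.
have h : (1 - t) * (v.1 ^+ 2 * k) <= r ^+ 2 by lra.
have t2 : 0 <= (1 + t) ^+ 2 by apply: sqr_ge0.
apply: le_trans (ler_wpM2l t2 h).
have kv : 0 <= v.1 ^+ 2 * k by rewrite mulr_ge0 ?sqr_ge0 // ltW.
rewrite mulrA ler_peMl //.
have : 0 <= t * (1 / 2 - t) by rewrite mulr_ge0 //; lra.
have : 0 <= t ^+ 2 * (1 / 2 - t) by rewrite mulr_ge0 ?sqr_ge0 //; lra.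
lra.
Qed.

(** Stated for an arbitrary F so that it serves both for the area and for the
number of lattice points. Monotonicity is required only between sectors and
triangles, because cardinality and measure are monotone only for finite,
respectively measurable and bounded, sets. *)
Lemma sandwich (F : set (R * R) -> R) (eps : R -> R) alpha :
  (forall r, 0 < r -> 0 < eps r) -> eps r @[r --> +oo] --> (0 : R) ->
  (forall e x r, 0 < e -> 0 < x -> tri alpha e x `<=` sect alpha e r ->
     F (tri alpha e x) <= F (sect alpha e r)) ->
  (forall e x r, 0 < e -> 0 < x -> sect alpha e r `<=` tri alpha e x ->
     F (sect alpha e r) <= F (tri alpha e x)) ->
  (forall l t, 0 < l -> 0 < t -> \forall r \near +oo,
     `|F (tri alpha (eps r) (l * r)) - eps r * (l * r) ^+ 2|
       <= t * (eps r * (l * r) ^+ 2)) ->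
  F (sect alpha (eps r) r) / (eps r * r ^+ 2 / (1 + alpha ^+ 2)) @[r --> +oo]
    --> (1 : R).
Proof.
move=> eps0 epsc Fle1 Fle2 Ftri; apply/cvgrPdist_le => d d0.
have k0 : 0 < 1 + alpha ^+ 2 by rewrite ltr_pwDl ?sqr_ge0.
have sk0 : 0 < Num.sqrt (1 + alpha ^+ 2) by rewrite sqrtr_gt0.
(* The relative error is at most (1 + t)^3 - 1 <= 7 t. *)
pose t := Num.min (1 / 2) (d / 7).
have t0 : 0 < t by rewrite lt_min !divr_gt0.
have t1 : t <= 1 / 2 by rewrite ge_min lexx.
have td : 7 * t <= d by rewrite mulrC -ler_pdivlMr // ge_min lexx orbT.
have a0 : 0 < 2 * `|alpha| + 1 by rewrite ltr_wpDl // mulr_ge0.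
pose l1 := (1 - t) / Num.sqrt (1 + alpha ^+ 2).
pose l2 := (1 + t) / Num.sqrt (1 + alpha ^+ 2).
have l10 : 0 < l1 by rewrite divr_gt0 //; lra.
have l20 : 0 < l2 by rewrite divr_gt0 //; lra.
near=> r.
have r0 : 0 < r by near: r; apply: nbhs_pinfty_gt.
have e0 := eps0 _ r0.
have et : eps r * (2 * `|alpha| + 1) <= t.
  rewrite -ler_pdivlMr //; apply: (le_trans (ler_norm _)).
  rewrite -normrN -[- _]sub0r; near: r.
  by move/cvgrPdist_le: epsc; apply; rewrite divr_gt0.
have h1 : `|F (tri alpha (eps r) (l1 * r)) - eps r * (l1 * r) ^+ 2|
   <= t * (eps r * (l1 * r) ^+ 2) by near: r; apply: Ftri.
have h2 : `|F (tri alpha (eps r) (l2 * r)) - eps r * (l2 * r) ^+ 2|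
   <= t * (eps r * (l2 * r) ^+ 2) by near: r; apply: Ftri.
have /(Fle1 _ _ _ e0 (mulr_gt0 l10 r0)) g1 := tri_sub_sect t1 e0 et r0.
have /(Fle2 _ _ _ e0 (mulr_gt0 l20 r0)) g2 := sect_sub_tri t1 e0 et r0.
set B := eps r * r ^+ 2 / (1 + alpha ^+ 2).
have B0 : 0 < B by rewrite divr_gt0 // mulr_gt0 // exprn_gt0.
have E1 : eps r * (l1 * r) ^+ 2 = (1 - t) ^+ 2 * B.
  by rewrite !exprMn exprVn sqr_sqrtr ?(ltW k0) // /B; ring.
have E2 : eps r * (l2 * r) ^+ 2 = (1 + t) ^+ 2 * B.
  by rewrite !exprMn exprVn sqr_sqrtr ?(ltW k0) // /B; ring.
rewrite E1 in h1; rewrite E2 in h2.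
have b0 := ltW B0.
have b1 : 0 <= t * B by rewrite mulr_ge0 // ltW.
have b2 : 0 <= t ^+ 2 * B by rewrite mulr_ge0 ?sqr_ge0.
have b3 : t ^+ 2 * B <= t * B by rewrite ler_wpM2r // expr2 ger_pMl //; lra.
have b4 : t ^+ 3 * B <= t * B.
  by apply: le_trans b3; rewrite ler_wpM2r // exprS ger_pMl ?exprn_gt0 //; lra.
have tB : 7 * t * B <= d * B by rewrite ler_wpM2r.
rewrite distrC -(ler_pM2r B0) -[X in _ * X <= _](gtr0_norm B0) -normrM.
rewrite mulrBl mulfVK ?gt_eqF // mul1r.
move: h1 h2; rewrite !ler_norml => /andP[h1 _] /andP[_ h2].
by rewrite -!/l1 -!/l2 in g1 g2; apply/andP; split; lra.
Unshelve. all: by end_near.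
Qed.

End sandwich.

(** * Asymptotics *)

Section asymptotics.
Context {R : realType}.
Implicit Types (alpha eta e x r : R) (eps : R -> R).
Local Notation mu := (@lebesgue_measure R).

Lemma tri_bounded alpha e x : 0 < e -> 0 < x ->
  tri alpha e x `<=` sect alpha e ((1 + `|alpha| + e) * x).
Proof.
move=> e0 x0 [y z] [/= /andP[y0 yx] hz].
have a0 : 0 <= `|alpha| by [].
split=> //=; last by rewrite (sect_cone _ _ (v := (y, z))).
have zb : `|z| <= (`|alpha| + e) * x.
  rewrite (_ : z = (z - alpha * y) + alpha * y); last by rewrite subrK.
  apply: (le_trans (ler_normD _ _)); rewrite normrM (gtr0_norm y0).
  have := ler_wpM2l a0 yx; have := ler_wpM2l (ltW e0) yx; lra.
have b0 : 0 <= (`|alpha| + e) * x by rewrite mulr_ge0 ?(ltW x0) // addr_ge0 ?(ltW e0).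
have := ler_pM (normr_ge0 z) (normr_ge0 z) zb zb.
have := ler_pM (ltW y0) (ltW y0) yx yx.
rewrite -!expr2 real_normK ?num_real //.
have := mulr_ge0 b0 (ltW x0); lra.
Qed.

Lemma sect_bounded alpha e r : sect alpha e r `<=` tri alpha e (`|r| + 1).
Proof.
move=> v [v0 vr]; rewrite sect_cone // => hv; split=> //; rewrite v0 /=.
have : v.1 ^+ 2 <= r ^+ 2 by apply: le_trans vr; rewrite lerDl sqr_ge0.
rewrite -[r ^+ 2]real_normK ?num_real // => h.
have : v.1 <= `|r| by rewrite -ler_sqr // nnegrE ltW.
lra.
Qed.

(** [card_tri] with the denominator given by [of_type_approx] for N the integer
part of h l r, where h is a small fraction of t: q <= N makes q small relative
to l r, and q >= c N^(1 / eta) makes e l r q large. *)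
Lemma card_tri_asymp alpha eta eps l t : of_type alpha eta ->
  (forall r, 0 < r -> 0 < eps r) ->
  (eps r * r `^ (1 + 1 / eta)) @[r --> +oo] --> +oo ->
  0 < l -> 0 < t -> \forall r \near +oo,
    `|#|` fset_set (lattice_pts (tri alpha (eps r) (l * r)))|%:R
      - eps r * (l * r) ^+ 2| <= t * (eps r * (l * r) ^+ 2).
Proof.
move=> ta eps0 epsoo l0 t0.
have [c c0 approx] := of_type_approx ta.
(* The constant 11 is the one in [card_tri]. *)
pose h : R := Num.min (1 / 2) (t / 11).
have h0 : 0 < h by rewrite lt_min !divr_gt0.
have h1 : h <= 1 / 2 by rewrite ge_min lexx.
have ht : 11 * h <= t by rewrite mulrC -ler_pdivlMr // ge_min lexx orbT.
have hl0 : 0 < h * l by rewrite mulr_gt0.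
pose C := c * (h * l / 2) `^ (1 / eta).
have C0 : 0 < C by rewrite mulr_gt0 // powR_gt0 // divr_gt0.
near=> r.
have r0 : 0 < r by near: r; apply: nbhs_pinfty_gt.
have r1 : (h * l)^-1 <= r by near: r; apply: nbhs_pinfty_ge; rewrite num_real.
have big : (h * l * C)^-1 <= eps r * r `^ (1 + 1 / eta).
  by near: r; move/cvgryPge: epsoo; apply.
have e0 := eps0 _ r0.
have hlr1 : 1 <= h * l * r by rewrite -ler_pdivrMl // mulr1.
pose N := Num.truncn (h * l * r).
have /andP[Nle Ngt] : N%:R <= h * l * r < N.+1%:R by apply: truncn_itv; lra.
have N0 : (0 < N)%N by rewrite truncn_gt0.
have N1 : 1 <= N%:R :> R by rewrite ler1n.
have [p [q [/andP[q0 qN] pq hq qge]]] := approx _ N0.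
have B0 : 0 <= eps r * (l * r) ^+ 2 by rewrite mulr_ge0 ?sqr_ge0 // ltW.
apply: le_trans (ler_wpM2r B0 ht).
apply: (card_tri e0 _ _ q0 pq hq) => //; first by rewrite mulr_gt0.
- by rewrite h0.
- by rewrite mulrA (le_trans _ Nle) // ler_nat.
have Cq : C * r `^ (1 / eta) <= q%:R.
  apply: le_trans qge; rewrite -mulrA ler_pM2l //.
  have hl2 : 0 <= h * l / 2 by rewrite divr_ge0 ?ltW.
  rewrite -(powRM _ hl2 (ltW r0)); apply: ge0_ler_powR;
    rewrite ?nnegrE ?divr_ge0 ?(ltW (of_type_gt0 ta)) //.
    by rewrite mulr_ge0 // ltW.
  by rewrite -natr1 in Ngt; lra.
have hC0 : 0 < h * l * C by rewrite mulr_gt0.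
have : 1 <= h * l * C * (eps r * r `^ (1 + 1 / eta)) by rewrite -ler_pdivrMl // mulr1.
move=> /le_trans; apply.
rewrite powRD; last by apply/implyP => _; rewrite gt_eqF.
rewrite powRr1 ?(ltW r0) //.
have -> : h * l * C * (eps r * (r * r `^ (1 / eta)))
  = h * (eps r * (l * r)) * (C * r `^ (1 / eta)) by ring.
by rewrite [leRHS]mulrA ler_wpM2l // !mulr_ge0 // ltW.
Unshelve. all: by end_near.
Qed.

Lemma sect_count_asymp alpha eta eps : of_type alpha eta ->
  (forall r, 0 < r -> 0 < eps r) -> eps r @[r --> +oo] --> (0 : R) ->
  (eps r * r `^ (1 + 1 / eta)) @[r --> +oo] --> +oo ->
  asymp_pinfty (fun r => (sect_count alpha (eps r) r)%:R)
               (fun r => area (sect alpha (eps r) r)).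
Proof.
move=> ta eps0 epsc epsoo; rewrite /asymp_pinfty.
(* The common equivalent of both quantities. *)
pose B r := eps r * r ^+ 2 / (1 + alpha ^+ 2).
have k0 : 0 < 1 + alpha ^+ 2 by rewrite ltr_pwDl ?sqr_ge0.
have finT e x : 0 < e -> 0 < x -> finite_set (lattice_pts (tri alpha e x)).
  move=> e0 x0; apply: (@sub_finite_set _ _ _ _ (finite_lattice_pts_sect _ _ _)).
  by move=> v; exact: tri_bounded.
have cnt : (sect_count alpha (eps r) r)%:R / B r @[r --> +oo] --> (1 : R).
  apply: (@sandwich _ (fun A => #|` fset_set (lattice_pts A)|%:R)) => //.
  - move=> e x r e0 x0 sub; rewrite ler_nat; apply: leq_card_fset_set_sub.
      exact: finite_lattice_pts_sect.
    by move=> v /sub.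
  - move=> e x r e0 x0 sub; rewrite ler_nat; apply: leq_card_fset_set_sub.
      exact: finT.
    by move=> v /sub.
  - by move=> l t l0 t0; exact: card_tri_asymp ta eps0 epsoo l0 t0.
have ar : area (sect alpha (eps r) r) / B r @[r --> +oo] --> (1 : R).
  apply: (@sandwich _ (@area R)) => //.
  - move=> e x r e0 x0 sub; apply: area_le => //.
    + exact: measurable_tri.
    + exact: measurable_sect.
    + apply: (@le_lt_trans _ _ ((mu \x mu)%E (tri alpha e (`|r| + 1)))).
        apply: le_measure; rewrite ?inE.
        * exact: measurable_sect.
        * exact: measurable_tri.
        * exact: sect_bounded.
      by rewrite lebesgue_tri ?ltry // ltr_wpDl.
  - move=> e x r e0 x0 sub; apply: area_le => //.
    + exact: measurable_sect.
    + exact: measurable_tri.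
    + by rewrite lebesgue_tri // ltry.
  - move=> l t l0 t0; near=> r.
    have r0 : 0 < r by near: r; apply: nbhs_pinfty_gt.
    rewrite area_tri ?mulr_gt0 ?eps0 // subrr normr0.
    by rewrite !mulr_ge0 ?sqr_ge0 // ltW ?eps0.
have quo : ((sect_count alpha (eps r) r)%:R / B r)
    * (area (sect alpha (eps r) r) / B r)^-1 @[r --> +oo] --> (1 : R).
  rewrite -[X in _ --> X](_ : (1 * 1^-1 : R) = 1); last by rewrite invr1 mulr1.
  by apply: cvgM cnt _; apply: cvgV => //; exact: oner_neq0.
refine (cvg_trans (near_eq_cvg _) quo); near=> r.
have r0 : 0 < r by near: r; apply: nbhs_pinfty_gt.
have Br : B r != 0 by rewrite gt_eqF // divr_gt0 // mulr_gt0 ?exprn_gt0 ?eps0.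
by move: (B r) Br => b b0; rewrite invf_div mulrA divfK.
Unshelve. all: by end_near.
Qed.

(** The type 1 + e has 1 / (1 + e) as close to 1 as desired; the maximum with
1 / 2 in the proof only keeps that quantity positive when t <= 1. *)
Lemma diophantine_exponent (t : R) : t < 2 ->
  exists2 e : R, 0 < e & t <= 1 + 1 / (1 + e).
Proof.
move=> t2; pose s := Num.max (t - 1) (1 / 2).
have s0 : 0 < s by rewrite lt_max divr_gt0 // orbT.
have s1 : s < 1 by rewrite gt_max; apply/andP; split; lra.
exists (s^-1 - 1); first by rewrite subr_gt0 invf_gt1.
rewrite (_ : 1 + (s^-1 - 1) = s^-1); last by ring.
rewrite invrK mul1r.
have : t - 1 <= s by rewrite le_max lexx.
lra.
Qed.

End asymptotics.

Unset Implicit Arguments.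

Theorem mainTheorem3 (R : realType) (eps : R -> R)
    (eps_gt0 : forall r : R, 0 < r -> 0 < eps r)
    (eps_cvg0 : eps r @[r --> +oo] --> (0 : R)) :
  (forall alpha eta : R, irrational alpha -> of_type alpha eta ->
     (eps r * r `^ (1 + 1 / eta)) @[r --> +oo] --> +oo ->
     asymp_pinfty (fun r => (sect_count alpha (eps r) r)%:R)
                  (fun r => area (sect alpha (eps r) r)))
  /\
  (forall alpha : R, diophantine alpha ->
     (exists2 t : R, t < 2 & (eps r * r `^ t) @[r --> +oo] --> +oo) ->
     asymp_pinfty (fun r => (sect_count alpha (eps r) r)%:R)
                  (fun r => area (sect alpha (eps r) r))).
Proof.
split=> [alpha eta _ ta epsoo|alpha [_ ta] [t t2 epsoo]].
  exact: sect_count_asymp ta _ _ epsoo.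
have [e e0 te] := diophantine_exponent t2.
apply: (sect_count_asymp (ta _ e0)) => //.
apply: ger_cvgy epsoo; near=> r.
have r1 : 1 <= r by near: r; apply: nbhs_pinfty_ge; rewrite num_real.
by rewrite ler_wpM2l ?ler_powR // ltW // eps_gt0 // (lt_le_trans ltr01).
Unshelve. all: by end_near.
Qed.
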